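(* For any graph $G$ with at least one edge we have $$0\leq\alpha_{\rm es}(G)\leq\alpha(G)-1.$$
   Context: All graphs are finite and simple; $\alpha(G)$ is the independence number of $G$. For $B\subseteq V(G)$, $N[B]=\bigcup_{b\in B}N[b]$ and $N(B)=N[B]- B$. A set $B\subseteq V(G)$ is an externally supported independence set (ESI-set) if $B$ is independent and every $v\in N(B)$ has a neighbor in $V(G)- N[B]$ (the empty set is an ESI-set). The externally supported independence number $\alpha_{\rm es}(G)$ is the maximum cardinality of an ESI-set of $G$. *)

(* Defs.v *)
From mathcomp Require Import all_boot all_order all_algebra.
Set Implicit Arguments. Unset Strict Implicit. Unset Printing Implicit Defensive.

Record sgraph := SGraph {
  vertex :> finType;
  edge : rel vertex;
  edge_sym : symmetric edge;
  edge_irrefl : irreflexive edge }.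

Section Graph.
Variable G : sgraph.
Implicit Types (v : G) (B : {set G}).

Definition closed_nbhd v : {set G} := v |: [set u | edge v u].

Definition closed_nbhd_set B : {set G} := \bigcup_(b in B) closed_nbhd b.

(* N(B) = N[B] - B; for non-independent B this is smaller than the union of
   the open neighbourhoods of the members of B. *)
Definition open_nbhd_set B : {set G} := closed_nbhd_set B :\: B.

Definition independent B : bool :=
  [forall u in B, forall v in B, ~~ edge u v].

Definition ESI_set B : bool :=
  independent B &&
  [forall v in open_nbhd_set B,
     exists u in [set: G] :\: closed_nbhd_set B, edge v u].

Lemma independent0 : independent set0.
Proof. by apply/forall_inP => u; rewrite inE. Qed.

Lemma ESI_set0 : ESI_set set0.
Proof.
rewrite /ESI_set independent0 /=; apply/forall_inP => v.
by rewrite /open_nbhd_set /closed_nbhd_set big_set0 setD0 inE.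
Qed.

(* Both maxima range over a nonempty family, by the two lemmas above, so the
   default value 0 of \max plays no role. *)
Definition independence_number : nat :=
  \max_(B : {set G} | independent B) #|B|.

Definition es_independence_number : nat :=
  \max_(B : {set G} | ESI_set B) #|B|.

End Graph.

(* Main.v *)
Require Import Defs.
From mathcomp Require Import all_boot all_order all_algebra.
Set Implicit Arguments. Unset Strict Implicit. Unset Printing Implicit Defensive.

(* An ESI-set [B] never dominates [G]: a vertex of [N(B)] has a neighbor outside
   [N[B]], and if [N(B)] is empty while [N[B] = V(G)], then [B = V(G)], which is
   not independent since [G] has an edge. A vertex outside [N[B]] then extends
   [B] to a larger independent set. *)

Lemma notin_closed_nbhd_set (G : sgraph) (B : {set G}) (w : G) :
  w \notin closed_nbhd_set B ->
  w \notin B /\ forall b, b \in B -> ~~ edge b w.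
Proof.
move=> wNB.
have notin_nbhd b : b \in B -> w \notin closed_nbhd b.
  by move=> bB; apply: contra wNB => wb; apply/bigcupP; exists b.
split=> [|b /notin_nbhd].
  by apply/negP => /notin_nbhd; rewrite !inE eqxx.
by rewrite !inE negb_or => /andP[].
Qed.

Lemma independentU1 (G : sgraph) (B : {set G}) (w : G) :
  independent B -> w \notin closed_nbhd_set B -> independent (w |: B).
Proof.
move=> indB /notin_closed_nbhd_set[_ wB].
apply/forall_inP => u uB; apply/forall_inP => v; move: uB.
rewrite !inE => /predU1P[->|uB] /predU1P[->|vB].
- by rewrite edge_irrefl.
- by rewrite edge_sym wB.
- exact: wB.
- by have /forall_inP/(_ u uB)/forall_inP/(_ v vB) := indB.
Qed.

Lemma ESI_set_not_dominating (G : sgraph) (B : {set G}) (u v : G) :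
  edge u v -> ESI_set B -> exists w, w \notin closed_nbhd_set B.
Proof.
move=> uv /andP[indB /forall_inP extB].
case: (set_0Vmem (open_nbhd_set B)) => [openB0|[x /extB /exists_inP[w]]].
  (* When N(B) is empty, it is enough to test the two ends of the edge: one of them is the witness
     unless both lie in N[B], hence in [B], against independence. *)
  have [uB|uB] := boolP (u \in closed_nbhd_set B); last by exists u.
  have [vB|vB] := boolP (v \in closed_nbhd_set B); last by exists v.
  have sub x : x \in closed_nbhd_set B -> x \in B.
    by move=> xB; move/setP/(_ x): openB0; rewrite !inE xB andbT => /negbFE.
  move/forall_inP/(_ u (sub u uB))/forall_inP/(_ v (sub v vB)): indB.
  by rewrite uv.
by rewrite inE => /andP[wB _] _; exists w.
Qed.

Lemma ESI_set_card_lt (G : sgraph) (B : {set G}) (u v : G) :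
  edge u v -> ESI_set B -> #|B| < independence_number G.
Proof.
move=> uv esB; have [w wNB] := ESI_set_not_dominating uv esB.
have /andP[indB _] := esB; have [wB _] := notin_closed_nbhd_set wNB.
have indwB := independentU1 indB wNB.
(* Strictness comes from [w] lying outside [B]. *)
apply: (@leq_trans #|w |: B|); first by rewrite cardsU1 wB.
exact: (@leq_bigmax_cond _ _ (fun A : {set G} => #|A|)).
Qed.

Theorem theorem7 (G : sgraph) (hE : exists u v : G, edge u v) :
  (0 <= (es_independence_number G)%:Z <= (independence_number G)%:Z - 1)%R.
Proof.
have [u [v uv]] := hE.
(* Positivity, from the strict bound at the empty ESI-set, makes the integer difference agree with
   truncated subtraction on [nat]; the lower bound 0 then holds by computation. *)
have alpha_gt0 : 0 < independence_number G.
  exact: leq_ltn_trans (leq0n _) (ESI_set_card_lt uv (ESI_set0 G)).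
rewrite (subzn alpha_gt0) /= lez_nat; apply/bigmax_leqP => B esB.
by rewrite leq_subRL // add1n (ESI_set_card_lt uv esB).
Qed.
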